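(* Let $G$ be a complete $k$-partite graph on $n$ vertices. Then $$\mathcal{E}_{RD}(CS(n,k-1))\le \mathcal{E}_{RD}(G)\le \mathcal{E}_{RD}(T(n,k)).$$ Moreover, the left equality holds if and only if $G\cong CS(n,k-1)$, and the right equality holds if and only if $G\cong T(n,k)$.
   Context: For a connected graph $G$ with vertices $v_1,\dots,v_n$, $RD(G)$ is the $n\times n$ matrix with $(i,j)$ entry $1/d(v_i,v_j)$ for $i\ne j$ and $0$ on the diagonal ($d$ the shortest-path distance), and $\mathcal{E}_{RD}(G)=\sum_{i=1}^n|\lambda_i(RD(G))|$. The complete split graph $CS(n,k-1)$ is the complete $k$-partite graph $K_{n-k+1,1,1,\dots,1}$ (one part of size $n-k+1$ and $k-1$ parts of size $1$), i.e. a copy of $K_{k-1}$ with each of its vertices joined to $n-k+1$ independent vertices. The Turán graph $T(n,k)$ is the complete $k$-partite graph on $n$ vertices whose part sizes differ pairwise by at most one: writing $n=kq+r$ with $0\le r<k$, it has $r$ parts of size $q+1$ and $k-r$ parts of size $q$. *)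

(* Defs.v *)
From HB Require Import structures.
From mathcomp Require Import all_boot all_order all_algebra.

Set Implicit Arguments.
Unset Strict Implicit.
Unset Printing Implicit Defensive.

Import Order.TTheory GRing.Theory Num.Theory.
Local Open Scope ring_scope.

Record sgraph := SGraph {
  vertex :> finType;
  adj : rel vertex;
  adj_sym : symmetric adj;
  adj_irrefl : irreflexive adj
}.

Definition graph_iso (G H : sgraph) : Prop :=
  exists2 f : G -> H, bijective f & forall x y, adj (f x) (f y) = adj x y.

Definition has_walk (G : sgraph) (x y : G) (l : nat) : bool :=
  [exists p : l.-tuple G, path (@adj G) x p && (last x p == y)].

(* A shortest walk has length < #|G|; the value is meaningless (#|G|) when *)
(* x and y lie in different components.                                    *)
Definition dist (G : sgraph) (x y : G) : nat :=
  find (has_walk x y) (iota 0 #|G|).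

(* Entries between different components are 0, i.e. 1/oo; this never occurs *)
(* in a connected graph.                                                    *)
Definition RD (C : numClosedFieldType) (G : sgraph) : 'M[C]_#|G| :=
  \matrix_(i, j)
    let x := enum_val i in let y := enum_val j in
    if (x != y) && connect (@adj G) x y then (dist x y)%:R^-1 else 0.

(* The roots of the characteristic polynomial, listed with multiplicity. *)
Definition eigenvalues (C : numClosedFieldType) (n : nat) (A : 'M[C]_n) :
    seq C :=
  sval (closed_field_poly_normal (char_poly A)).

Lemma char_poly_eigenvalues (C : numClosedFieldType) (n : nat) (A : 'M[C]_n) :
  char_poly A = \prod_(z <- eigenvalues A) ('X - z%:P).
Proof.
rewrite /eigenvalues; case: closed_field_poly_normal => s /= {1}->.
by rewrite (monicP (char_poly_monic A)) scale1r.
Qed.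

(* RD C G is a real symmetric matrix over C, so its eigenvalues and the     *)
(* energy are real elements of C, compared by the order of C.               *)
Definition RD_energy (C : numClosedFieldType) (G : sgraph) : C :=
  \sum_(z <- eigenvalues (RD C G)) `|z|.

(* The blocks of a partition are nonempty, so there are exactly k parts. *)
Definition complete_kpartite (k : nat) (G : sgraph) : Prop :=
  exists P : {set {set G}},
    [/\ partition P [set: G], #|P| = k
      & forall x y : G, adj x y = (pblock P x != pblock P y)].

Section PartSizes.
Variables (k : nat) (m : 'I_k -> nat).

Definition parts_vertex : finType := {i : 'I_k & 'I_(m i)}.

Definition parts_adj : rel parts_vertex := fun u v => tag u != tag v.

Lemma parts_adj_sym : symmetric parts_adj.
Proof. by move=> u v; rewrite /parts_adj eq_sym. Qed.

Lemma parts_adj_irrefl : irreflexive parts_adj.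
Proof. by move=> u; rewrite /parts_adj eqxx. Qed.

(* K_{m_0, ..., m_(k-1)} *)
Definition multipartite : sgraph := SGraph parts_adj_sym parts_adj_irrefl.

End PartSizes.

(* CS n s = K_{n-s, 1, ..., 1} with s parts of size 1; meaningful for s <= n. *)
Definition CS (n s : nat) : sgraph :=
  multipartite (fun i : 'I_s.+1 => if i == ord0 then (n - s)%N else 1%N).

Definition turan (n k : nat) : sgraph :=
  multipartite
    (fun i : 'I_k => if (i < n %% k)%N then (n %/ k).+1 else (n %/ k)%N).

(* Main.v *)
Require Import Defs.
From mathcomp Require Import all_boot all_order all_algebra.
From mathcomp Require Import perm spectral ring.

Set Implicit Arguments.
Unset Strict Implicit.
Unset Printing Implicit Defensive.

Import Order.TTheory GRing.Theory Num.Theory.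
Local Open Scope ring_scope.

(* For k >= 2, RD(G) = J - (I + B B^T) / 2 with B the incidence matrix of     *)
(* vertices and parts. The form is negative on the hyperplane orthogonal to   *)
(* the all-ones vector, so a single eigenvalue lam is >= 0, and trace 0 gives *)
(* the energy E = 2 lam. The eigenvector equation becomes                     *)
(*   sum_l m_l / (E + 1 + m_l) = 1 / 2,  m_l the part sizes.                  *)
(* The left side decreases in E, and t / (a + t) is strictly concave: by the  *)
(* secant through q and q + 1 (resp. through 1 and n - k + 1) the sum is      *)
(* largest (resp. smallest) exactly for the sizes of the Turan graph (resp.   *)
(* of the complete split graph), and E follows. For k = 1 the graphs with n   *)
(* vertices are all isomorphic.                                               *)

(** * The energy of a traceless Hermitian form negative on a hyperplane *)

Lemma char_poly_conj (R : comUnitRingType) (n : nat) (P A : 'M[R]_n) :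
  P \in unitmx -> char_poly (invmx P *m A *m P) = char_poly A.
Proof.
move=> uP; rewrite /char_poly.
pose Q := map_mx polyC P; pose Q' := map_mx polyC (invmx P).
have Q'Q : Q' *m Q = 1%:M by rewrite -map_mxM mulVmx // map_mx1.
have -> : char_poly_mx (invmx P *m A *m P) = Q' *m char_poly_mx A *m Q.
  rewrite /char_poly_mx mulmxBr mulmxBl !map_mxM; congr (_ - _).
  by rewrite scalar_mxC -mulmxA Q'Q mulmx1.
by rewrite !det_mulmx mulrAC -det_mulmx Q'Q det1 mul1r.
Qed.

Lemma char_poly_mxsub_bij (R : comNzRingType) (m n : nat) (h : 'I_m -> 'I_n)
    (A : 'M[R]_n) :
  bijective h -> char_poly (mxsub h h A) = char_poly A.
Proof.
move=> bij_h; have eq_mn : m = n.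
  by have := bij_eq_card bij_h; rewrite !card_ord.
subst m; pose s := perm (bij_inj bij_h).
have -> : char_poly (mxsub h h A)
          = \det (row_perm s (col_perm s (char_poly_mx A))).
  congr determinant; apply/matrixP => i j.
  by rewrite !mxE -!(permE (bij_inj bij_h)) (inj_eq perm_inj).
rewrite row_permE col_permE !det_mulmx !det_perm odd_permV.
by rewrite mulrCA -signr_addb addbb mulr1.
Qed.

Lemma perm_eigenvalues_conj_diag (C : numClosedFieldType) (n : nat)
    (P : 'M[C]_n) (d : 'rV[C]_n) :
  P \in unitmx ->
  perm_eq (eigenvalues (invmx P *m diag_mx d *m P)) [seq d 0 i | i : 'I_n].
Proof.
move=> uP; apply: prod_XsubC_eq.
rewrite -char_poly_eigenvalues char_poly_conj //.
rewrite char_poly_trig ?diag_mx_is_trig // big_image /=.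
by apply: eq_bigr => i _; rewrite mxE eqxx mulr1n.
Qed.

Lemma mem_eigenvalues (C : numClosedFieldType) (n : nat) (A : 'M[C]_n) (z : C) :
  (z \in eigenvalues A) = eigenvalue A z.
Proof.
rewrite eigenvalue_root_char char_poly_eigenvalues.
by rewrite root_prod_XsubC.
Qed.

Lemma dotmx_conj_diag (C : numClosedFieldType) (n : nat) (P : 'M[C]_n)
    (d u : 'rV[C]_n) :
  P \is unitarymx ->
  dotmx (u *m P *m (invmx P *m diag_mx d *m P)) (u *m P)
  = \sum_i d 0 i * `|u 0 i| ^+ 2.
Proof.
move=> uP; rewrite dotmxE trmx_mul map_mxM !mulmxA mulmxK ?unitarymx_unit //.
rewrite mulmxtVK // mul_mx_diag mxE; apply: eq_bigr => i _.
by rewrite !mxE normCK; ring.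
Qed.

Lemma exists_orthogonal_on_pair (F : fieldType) (n : nat) (y : 'cV[F]_n)
    (i j : 'I_n) :
  i != j ->
  exists u : 'rV_n,
    [/\ u != 0, u *m y = 0 & forall l, l != i -> l != j -> u 0 l = 0].
Proof.
move=> ij; have delta_mul (l : 'I_n) : delta_mx 0 l *m y = (y l 0)%:M.
  by rewrite -rowE; apply/matrixP => s t; rewrite !ord1 !mxE mulr1n.
have [yi0|yi0] := eqVneq (y i 0) 0.
  exists (delta_mx 0 i); split=> [||l li _].
  - by apply/rV0Pn; exists i; rewrite mxE !eqxx oner_eq0.
  - by rewrite delta_mul yi0 -scalemx1 scale0r.
  - by rewrite mxE (negPf li) andbF.
exists (y j 0 *: delta_mx 0 i - y i 0 *: delta_mx 0 j); split.
- apply/rV0Pn; exists j; rewrite !mxE !eqxx /= [j == i]eq_sym (negPf ij).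
  by rewrite mulr0 mulr1 sub0r oppr_eq0.
- rewrite mulmxBl -!scalemxAl !delta_mul !scale_scalar_mx.
  by rewrite [y i 0 * _]mulrC subrr.
- by move=> l li lj; rewrite !mxE (negPf li) (negPf lj) !mulr0 subrr.
Qed.

(* Two nonnegative eigenvalues would span a plane meeting the hyperplane *)
(* orthogonal to w, on which the form is negative.                       *)
Lemma spectral_diag_lt0_pair (C : numClosedFieldType) (n : nat) (A : 'M[C]_n)
    (w : 'cV[C]_n) :
  A \is hermsymmx ->
  (forall v : 'rV_n, v != 0 -> v *m w = 0 -> dotmx (v *m A) v < 0) ->
  forall i j, i != j -> (spectral_diag A 0 i < 0) || (spectral_diag A 0 j < 0).
Proof.
move=> hermA negA i j ij.
have /orthomx_spectralP defA := hermitian_normalmx hermA.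
have /mxOverP realD := hermitian_spectral_diag_real hermA.
have unitaryP := spectral_unitarymx A.
move: (spectralmx A) (spectral_diag A) => P d in defA realD unitaryP *.
have unitP := unitarymx_unit unitaryP.
have [u [u_neq0 uPw0 u_supp]] := exists_orthogonal_on_pair (P *m w) ij.
have uP_neq0 : u *m P != 0.
  by apply: contraNneq u_neq0 => uP0; rewrite -[u](mulmxK unitP) uP0 mul0mx.
have {negA} := negA _ uP_neq0; rewrite -mulmxA uPw0 => /(_ erefl).
rewrite {1}defA dotmx_conj_diag //; apply: contraTT.
rewrite negb_or => /andP[di_nlt0 dj_nlt0].
have di_ge0 : 0 <= d 0 i by rewrite real_leNgt ?realD ?real0.
have dj_ge0 : 0 <= d 0 j by rewrite real_leNgt ?realD ?real0.
rewrite le_gtF // sumr_ge0 // => l _.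
have [->|li] := eqVneq l i; first by rewrite mulr_ge0 ?exprn_ge0.
have [->|lj] := eqVneq l j; first by rewrite mulr_ge0 ?exprn_ge0.
by rewrite u_supp // normr0 expr0n mulr0.
Qed.

Lemma sum_norm_unique_nonneg (R : numDomainType) (I : finType) (d : I -> R) :
  (0 < #|I|)%N -> (forall i, d i \is Num.real) -> \sum_i d i = 0 ->
  (forall i j, i != j -> (d i < 0) || (d j < 0)) ->
  exists2 i, 0 <= d i & \sum_i `|d i| = d i *+ 2.
Proof.
move=> /card_gt0P[i0 _] d_real sum0 d_lt0.
have [i di_ge0] : exists i, 0 <= d i.
  apply/existsP; apply: contra_eqT sum0; rewrite negb_exists => /forallP d_neg.
  suff /lt_eqF : \sum_i d i < \sum_(i : I) 0 by rewrite big1_eq => ->.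
  apply: ltr_sum => [|i _]; last by rewrite real_ltNge ?real0.
  by apply/hasP; exists i0; rewrite ?mem_index_enum.
exists i => //; rewrite (bigD1 i) //= ger0_norm // mulr2n; congr (_ + _).
move/eqP: sum0; rewrite (bigD1 i) //= addr_eq0 => /eqP ->.
rewrite -sumrN; apply: eq_bigr => j ji; rewrite ltr0_norm //.
by have := d_lt0 _ _ ji; rewrite [d i < 0]le_gtF // orbF.
Qed.

Definition energy (C : numClosedFieldType) (n : nat) (A : 'M[C]_n) : C :=
  \sum_(z <- eigenvalues A) `|z|.

Lemma energy_neg_hyperplane (C : numClosedFieldType) (n : nat) (A : 'M[C]_n)
    (w : 'cV[C]_n) :
  (0 < n)%N -> A \is hermsymmx -> \tr A = 0 ->
  (forall v : 'rV_n, v != 0 -> v *m w = 0 -> dotmx (v *m A) v < 0) ->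
  exists lam, [/\ 0 <= lam, eigenvalue A lam & energy A = lam *+ 2].
Proof.
move=> n_gt0 hermA trA negA.
have /orthomx_spectralP defA := hermitian_normalmx hermA.
have unitP : spectralmx A \in unitmx := spectral_unit A.
have eigA : perm_eq (eigenvalues A) [seq spectral_diag A 0 i | i : 'I_n].
  by rewrite {1}defA; exact: perm_eigenvalues_conj_diag.
have sum0 : \sum_i spectral_diag A 0 i = 0.
  by rewrite -mxtrace_diag -trA [in RHS]defA -mulmxA mxtrace_mulC mulmxK.
have [|i|i di_ge0 sumE] :=
    sum_norm_unique_nonneg _ _ sum0 (spectral_diag_lt0_pair hermA negA).
- by rewrite card_ord.
- exact: (mxOverP (hermitian_spectral_diag_real hermA)).
exists (spectral_diag A 0 i); split => //.
- by rewrite -mem_eigenvalues (perm_mem eigA) image_f.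
- by rewrite /energy (perm_big _ eigA) big_image.
Qed.

(** * Concavity of t / (a + t) *)

Definition ratio (R : fieldType) (a t : R) : R := t / (a + t).

Section SecantOfRatio.
Variables (R : numFieldType) (a p r : R).
Hypotheses (a_gt0 : 0 < a) (p_ge0 : 0 <= p) (r_ge0 : 0 <= r).

(* The line through the points of abscissa p and r of the graph of ratio a. *)
Definition ratio_secant (t : R) : R := (p * r + a * t) / ((a + p) * (a + r)).

Lemma ratio_sub_secant (t : R) : 0 <= t ->
  ratio a t - ratio_secant t
  = a / ((a + p) * (a + r) * (a + t)) * ((t - p) * (r - t)).
Proof.
move=> t_ge0; have nz u : 0 <= u -> a + u != 0.
  by move=> u_ge0; rewrite gt_eqF // ltr_wpDr.
by rewrite /ratio /ratio_secant; field; rewrite !nz.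
Qed.

Let coef_gt0 (t : R) : 0 <= t -> 0 < a / ((a + p) * (a + r) * (a + t)).
Proof. by move=> t_ge0; rewrite divr_gt0 ?mulr_gt0 ?ltr_wpDr. Qed.

Lemma ratio_eq_secant (t : R) : 0 <= t ->
  (ratio a t == ratio_secant t) = (t == p) || (t == r).
Proof.
move=> t_ge0; rewrite -subr_eq0 ratio_sub_secant // mulf_eq0.
by rewrite [_ / _ == 0]gt_eqF ?coef_gt0 //= mulf_eq0 !subr_eq0 [r == t]eq_sym.
Qed.

Lemma secant_leif_ratio (t : R) : p <= t <= r ->
  ratio_secant t <= ratio a t ?= iff (t == p) || (t == r).
Proof.
move=> /andP[pt tr]; have t_ge0 := le_trans p_ge0 pt.
split; last by rewrite eq_sym ratio_eq_secant.
rewrite -subr_ge0 ratio_sub_secant // mulr_ge0 ?(ltW (coef_gt0 _)) //.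
by rewrite mulr_ge0 ?subr_ge0.
Qed.

Lemma ratio_leif_secant (t : R) : 0 <= t -> p <= r -> (t <= p) || (r <= t) ->
  ratio a t <= ratio_secant t ?= iff (t == p) || (t == r).
Proof.
move=> t_ge0 pr out; split; last exact: ratio_eq_secant.
rewrite -subr_le0 ratio_sub_secant // mulr_ge0_le0 ?(ltW (coef_gt0 _)) //.
case/orP: out => [tp|rt].
  by rewrite mulr_le0_ge0 ?subr_le0 ?subr_ge0 ?(le_trans tp).
by rewrite mulr_ge0_le0 ?subr_le0 ?subr_ge0 ?(le_trans pr).
Qed.

End SecantOfRatio.

Definition two_valued (I : finType) (p r : nat) (m : I -> nat) : bool :=
  [forall i, (m i == p) || (m i == r)].

Section RatioSum.
Variables (R : numFieldType) (I : finType).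
Implicit Types (a : R) (m : I -> nat).

Definition ratio_sum a m : R := \sum_i ratio a (m i)%:R.

Lemma ratio_sum_anti m i : (0 < m i)%N ->
  {in Num.pos &, {homo ratio_sum^~ m : b a / a < b >-> b < a}}.
Proof.
move=> mi_gt0 b a; rewrite !posrE => b_gt0 a_gt0 ab.
have pos c t : 0 < c -> 0 < c + t%:R :> R by move=> ?; rewrite ltr_wpDr ?ler0n.
rewrite /ratio_sum (bigD1 i) //= [ltRHS](bigD1 i) //= ltr_leD //.
  by rewrite ltr_pM2l ?ltr0n // ltf_pV2 ?posrE ?pos // ltrD2r.
apply: ler_sum => j _; apply: ler_wpM2l; first exact: ler0n.
by rewrite lef_pV2 ?posrE ?pos // lerD2r ltW.
Qed.

Lemma ratio_sum_nmono m i : (0 < m i)%N ->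
  {in Num.pos &, {mono ratio_sum^~ m : a b /~ a <= b}}.
Proof.
move=> mi_gt0 a b a_gt0 b_gt0; apply: (real_nmono_in (ratio_sum_anti mi_gt0)).
  by rewrite inE a_gt0 gtr0_real.
by rewrite inE b_gt0 gtr0_real.
Qed.

Section TwoValued.
Variables (a : R) (p r : nat) (m' : I -> nat).
Hypotheses (a_gt0 : 0 < a) (m'_two_valued : two_valued p r m').

Lemma ratio_sum_two_valued m : (\sum_i m i = \sum_i m' i)%N ->
  ratio_sum a m' = \sum_i ratio_secant a p%:R r%:R (m i)%:R.
Proof.
move=> eq_sum; transitivity (\sum_i ratio_secant a p%:R r%:R (m' i)%:R).
  apply: eq_bigr => i _; apply/eqP; rewrite ratio_eq_secant ?ler0n // !eqr_nat.
  exact: (forallP m'_two_valued).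
by rewrite -!mulr_suml !big_split /= -!mulr_sumr -!natr_sum eq_sum.
Qed.

Lemma ratio_sum_leif_inside m :
  (\sum_i m i = \sum_i m' i)%N -> (forall i, (p <= m i <= r)%N) ->
  ratio_sum a m' <= ratio_sum a m ?= iff two_valued p r m.
Proof.
move=> eq_sum inside; rewrite (ratio_sum_two_valued eq_sum).
apply: leif_sum => i _; have := inside i; rewrite -!(ler_nat R) -!(eqr_nat R).
by apply: secant_leif_ratio; rewrite ?ler0n.
Qed.

Lemma ratio_sum_leif_outside m :
  (\sum_i m i = \sum_i m' i)%N -> (p <= r)%N ->
  (forall i, (m i <= p)%N || (r <= m i)%N) ->
  ratio_sum a m <= ratio_sum a m' ?= iff two_valued p r m.
Proof.
move=> eq_sum pr outside; rewrite (ratio_sum_two_valued eq_sum).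
apply: leif_sum => i _; have := outside i; rewrite -!(ler_nat R) -!(eqr_nat R).
by apply: ratio_leif_secant; rewrite ?ler0n ?ler_nat.
Qed.

End TwoValued.

Section EqualRatioSums.
Variables (a b : R) (p r : nat) (m m' : I -> nat) (i : I).
Hypotheses (a_gt0 : 0 < a) (b_gt0 : 0 < b).
Hypothesis m'_two_valued : two_valued p r m'.
Hypothesis eq_sum : (\sum_i m i = \sum_i m' i)%N.
Hypothesis eq_ratio_sum : ratio_sum a m = ratio_sum b m'.

Lemma ratio_sum_eq_leif_inside :
  (0 < m i)%N -> (forall j, (p <= m j <= r)%N) ->
  b <= a ?= iff two_valued p r m.
Proof.
move=> mi_gt0 inside.
rewrite -(nmono_in_leif (ratio_sum_nmono mi_gt0)) ?posrE // eq_ratio_sum.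
exact: ratio_sum_leif_inside.
Qed.

Lemma ratio_sum_eq_leif_outside :
  (0 < m' i)%N -> (p <= r)%N -> (forall j, (m j <= p)%N || (r <= m j)%N) ->
  a <= b ?= iff two_valued p r m.
Proof.
move=> mi_gt0 pr outside.
rewrite -(nmono_in_leif (ratio_sum_nmono mi_gt0)) ?posrE // -eq_ratio_sum.
exact: ratio_sum_leif_outside.
Qed.

End EqualRatioSums.
End RatioSum.

(** * Sizes of color classes *)

Definition class_size (T : finType) (K : eqType) (c : T -> K) (l : K) : nat :=
  #|[pred x | c x == l]|.

Lemma sum_class_size (T K : finType) (c : T -> K) :
  (\sum_l class_size c l = #|T|)%N.
Proof.
rewrite -sum1_card (partition_big c predT) //=.
by apply: eq_bigr => l _; rewrite sum1_card.
Qed.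

Lemma class_size_comp_bij (T U : finType) (K : eqType) (c : U -> K)
    (f : T -> U) :
  bijective f -> class_size (c \o f) =1 class_size c.
Proof.
move=> bij_f l; rewrite /class_size -!sum1_card.
by rewrite [RHS](reindex f) //; exact: onW_bij.
Qed.

Lemma class_size_tag (I : finType) (m : I -> nat) :
  class_size (fun u : {i : I & 'I_(m i)} => tag u) =1 m.
Proof.
move=> i; rewrite /class_size -[RHS]card_ord.
have Tagged_inj : injective (Tagged (fun j => 'I_(m j)) : 'I_(m i) -> _).
  by move=> x y /eqP; rewrite eq_Tagged => /eqP.
rewrite -(card_image Tagged_inj); apply: eq_card => -[j x]; rewrite !inE /=.
by apply/eqP/imageP => [ji|[y _ /(congr1 tag)]] //; subst j; exists x.
Qed.

Lemma class_size_add_card (T K : finType) (c : T -> K) (l : K) :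
  (forall l, 0 < class_size c l)%N -> (class_size c l + #|K| <= #|T|.+1)%N.
Proof.
move=> c_gt0; rewrite -(sum_class_size c) -sum1_card (bigD1 l) //=.
rewrite [X in (_ <= X.+1)%N](bigD1 l) //= addnCA add1n ltnS leq_add2l.
by apply: leq_sum => l' _; exact: c_gt0.
Qed.

Lemma leq_card_classes (T K : finType) (c : T -> K) :
  (forall l, 0 < class_size c l)%N -> (#|K| <= #|T|)%N.
Proof.
move=> c_gt0; rewrite -(sum_class_size c) -sum1_card.
by apply: leq_sum => l _; exact: c_gt0.
Qed.

Lemma class_injection (T U : finType) (K : eqType) (c : T -> K) (d : U -> K) :
  (forall l, class_size c l <= class_size d l)%N ->
  exists2 f : T -> U, injective f & forall x, d (f x) = c x.
Proof.
move=> le_cd.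
have class_mem x : x \in [pred y | c y == c x] by rewrite inE.
pose rank x := widen_ord (le_cd (c x)) (enum_rank_in (class_mem x) x).
have df x : d (enum_val (rank x)) = c x.
  by apply/eqP; have := enum_valP (rank x); rewrite inE.
exists (fun x => enum_val (rank x)) => // x y fxy.
have cxy : c x = c y by rewrite -df fxy df.
move: fxy; rewrite /rank.
move: (class_mem x) (class_mem y) (le_cd (c x)) (le_cd (c y)).
rewrite -cxy => px py lex ley /enum_val_inj /(congr1 val) /= /ord_inj.
exact: enum_rank_in_inj.
Qed.

Lemma class_bijection (T U : finType) (K : eqType) (c : T -> K) (d : U -> K) :
  class_size c =1 class_size d ->
  exists2 f : T -> U, bijective f & forall x, d (f x) = c x.
Proof.
move=> eq_cd.
have [l|f f_inj df] := class_injection (c := c) (d := d).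
  by rewrite eq_cd.
have [l|g g_inj _] := class_injection (c := d) (d := c).
  by rewrite eq_cd.
by exists f => //; apply: inj_card_bij f_inj (leq_card g g_inj).
Qed.

Lemma two_valuedE (I : finType) (p r : nat) (m : I -> nat) (i : I) :
  two_valued p r m -> m i = if m i == r then r else p.
Proof. by move=> /forallP/(_ i)/orP[] /eqP->; [case: eqP | rewrite eqxx]. Qed.

Lemma sum_two_valued (I : finType) (p r : nat) (m : I -> nat) :
  (p <= r)%N -> two_valued p r m ->
  (\sum_i m i = #|I| * p + (r - p) * #|[pred i | m i == r]|)%N.
Proof.
move=> le_pr m_pr; rewrite -sum_nat_const -sum1_card big_distrr /=.
rewrite [X in (_ + X)%N]big_mkcond -big_split; apply: eq_bigr => i _ /=.
rewrite {1}(two_valuedE i m_pr) inE.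
by case: eqP; rewrite ?muln1 ?subnKC ?addn0.
Qed.

Lemma two_valued_bijection (I : finType) (p r : nat) (m m' : I -> nat) :
  (p <= r)%N -> two_valued p r m -> two_valued p r m' ->
  (\sum_i m i = \sum_i m' i)%N ->
  exists2 s : I -> I, bijective s & forall i, m' (s i) = m i.
Proof.
move=> le_pr m_pr m'_pr; rewrite !(sum_two_valued le_pr) // => /addnI/eqP.
have [eq_pr _|ne_pr] := eqVneq p r.
  exists id => [|i]; first by exists id.
  by rewrite (two_valuedE i m_pr) (two_valuedE i m'_pr) eq_pr !if_same.
rewrite eqn_pmul2l ?subn_gt0 ?ltn_neqAle ?ne_pr // => /eqP eq_r.
have [b|s bij_s sP] :=
    class_bijection (c := fun i => m i == r) (d := fun i => m' i == r).
  have class_true u :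
      class_size (fun i : I => u i == r) true = #|[pred i | u i == r]|.
    by apply: eq_card => i; rewrite !inE eqb_id.
  have class_false u :
      class_size (fun i : I => u i == r) false
      = (#|I| - #|[pred i | u i == r]|)%N.
    rewrite -class_true -(sum_class_size (fun i => u i == r)) big_bool.
    by rewrite addKn.
  by case: b; rewrite ?class_true ?class_false eq_r.
exists s => // i.
by rewrite (two_valuedE (s i) m'_pr) (two_valuedE i m_pr) sP.
Qed.

(** * The reciprocal distance matrix of a complete multipartite graph *)

Section PartiteMatrix.
Variables (C : numClosedFieldType) (n : nat) (K : finType) (c : 'I_n -> K).

Definition partite_mx : 'M[C]_n :=
  \matrix_(i, j) (1 - ((i == j)%:R + (c i == c j)%:R) / 2).

Definition class_sum (v : 'rV[C]_n) (l : K) : C := \sum_(i | c i == l) v 0 i.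

Lemma sum_class_sum (v : 'rV[C]_n) : \sum_l class_sum v l = \sum_i v 0 i.
Proof. by rewrite [RHS](partition_big c predT). Qed.

Lemma mul_partite_mx (v : 'rV[C]_n) (j : 'I_n) :
  (v *m partite_mx) 0 j = \sum_i v 0 i - (v 0 j + class_sum v (c j)) / 2.
Proof.
have -> : v 0 j = \sum_i v 0 i * (i == j)%:R.
  rewrite (bigD1 j) //= eqxx mulr1 big1 ?addr0 // => i /negPf->.
  by rewrite mulr0.
have -> : class_sum v (c j) = \sum_i v 0 i * (c i == c j)%:R.
  rewrite /class_sum big_mkcond; apply: eq_bigr => i _.
  by case: eqP; rewrite ?mulr1 ?mulr0.
rewrite mxE -big_split mulr_suml -sumrB; apply: eq_bigr => i _ /=.
by rewrite mxE mulrBr mulr1 -mulrDr mulrA.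
Qed.

Lemma partite_mx_hermsym : partite_mx \is hermsymmx.
Proof.
apply: realsym_hermsym; last first.
  apply/mxOverP => i j; rewrite mxE.
  by rewrite realB ?realM ?realD ?realV ?realn ?real1.
apply/is_hermitianmxP/matrixP => i j.
by rewrite expr0 scale1r !mxE eq_sym (eq_sym (c i)).
Qed.

Lemma partite_mx_trace : \tr partite_mx = 0.
Proof.
by rewrite /mxtrace big1 // => i _; rewrite mxE !eqxx /=; field.
Qed.

Lemma dotmx_partite_mx (v : 'rV[C]_n) :
  dotmx (v *m partite_mx) v
  = `|\sum_i v 0 i| ^+ 2 - (dotmx v v + \sum_l `|class_sum v l| ^+ 2) / 2.
Proof.
have dotE u w : dotmx u w = \sum_i u 0 i * (w 0 i)^* :> C.
  by rewrite dotmxE mxE; apply: eq_bigr => i _; rewrite !mxE.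
have -> : \sum_l `|class_sum v l| ^+ 2 = \sum_i class_sum v (c i) * (v 0 i)^*.
  rewrite (partition_big c predT) //=; apply: eq_bigr => l _.
  rewrite normCK rmorph_sum mulr_sumr.
  by apply: eq_bigr => i /eqP->.
rewrite normCK rmorph_sum mulr_sumr !dotE -big_split mulr_suml -sumrB /=.
by apply: eq_bigr => i _; rewrite mul_partite_mx; ring.
Qed.

Lemma partite_mx_neg (v : 'rV[C]_n) :
  v != 0 -> v *m (const_mx 1 : 'cV_n) = 0 -> dotmx (v *m partite_mx) v < 0.
Proof.
move=> v_neq0 /matrixP/(_ 0 0); rewrite !mxE.
under eq_bigr do rewrite mxE mulr1.
move=> sum0; rewrite dotmx_partite_mx sum0 normr0 expr0n sub0r oppr_lt0.
rewrite divr_gt0 ?ltr0n // ltr_pwDl ?dotmx_is_dotmx //.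
by apply: sumr_ge0 => l _; rewrite exprn_ge0.
Qed.

(* The eigenvalue equation summed over the class l. *)
Lemma class_sum_eigenvector (lam : C) (v : 'rV[C]_n) (l : K) :
  0 <= lam -> v *m partite_mx = lam *: v ->
  class_sum v l
  = 2 * (\sum_i v 0 i) * ratio (lam *+ 2 + 1) (class_size c l)%:R.
Proof.
move=> lam_ge0 vA; set S := \sum_i v 0 i.
have nz : lam *+ 2 + 1 + (class_size c l)%:R != 0.
  by rewrite gt_eqF // ltr_wpDr ?ler0n // ltr_wpDl ?mulrn_wge0.
have : \sum_(j | c j == l) (S - (v 0 j + class_sum v l) / 2)
       = \sum_(j | c j == l) lam * v 0 j.
  apply: eq_bigr => j /eqP <-.
  by rewrite -mul_partite_mx vA mxE.
rewrite sumrB -mulr_suml big_split /= -mulr_sumr !sumr_const -/(class_sum v l).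
rewrite -[S *+ _]mulr_natr -[class_sum v l *+ _]mulr_natr.
rewrite -/(class_size c l) => /eqP; rewrite subr_eq => /eqP eqn.
apply: (mulIf nz); rewrite /ratio mulrA divfK //.
by rewrite -[2 * S * _]mulrA eqn; field.
Qed.

(* The total sum of an eigenvector is not 0: otherwise its class sums, hence *)
(* all its entries, would vanish.                                            *)
Lemma partite_mx_eigenvalue (lam : C) :
  0 <= lam -> eigenvalue partite_mx lam ->
  ratio_sum (lam *+ 2 + 1) (class_size c) = 2^-1.
Proof.
move=> lam_ge0 /eigenvalueP[v vA v_neq0].
have class_sumE l := class_sum_eigenvector l lam_ge0 vA.
set S := \sum_i v 0 i in class_sumE.
have S_neq0 : S != 0.
  apply: contra_neq v_neq0 => S0; apply/rowP => j; rewrite mxE.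
  have := mul_partite_mx v j; rewrite vA mxE class_sumE -/S S0.
  rewrite mulr0 mul0r addr0 sub0r => /eqP; rewrite -subr_eq0 opprK.
  rewrite [v 0 j / 2]mulrC -mulrDl mulf_eq0 gt_eqF ?orFb => [/eqP //|].
  by rewrite ltr_wpDl ?invr_gt0 ?ltr0n.
have nz : 2 * S != 0 by rewrite mulf_neq0 ?pnatr_eq0.
apply: (mulfI nz); rewrite mulr_sumr -(eq_bigr _ (fun l _ => class_sumE l)).
by rewrite sum_class_sum -/S; field.
Qed.

Lemma energy_partite_mx :
  (0 < n)%N -> ratio_sum (energy partite_mx + 1) (class_size c) = 2^-1.
Proof.
move=> n_gt0.
have [lam [lam_ge0 eig_lam ->]] := energy_neg_hyperplane n_gt0
  partite_mx_hermsym partite_mx_trace partite_mx_neg.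
exact: partite_mx_eigenvalue.
Qed.

End PartiteMatrix.

(** * Graph isomorphisms and distances *)

Lemma has_walk_homo (G H : sgraph) (f : G -> H) (x y : G) (l : nat) :
  {homo f : x y / adj x y} -> has_walk x y l -> has_walk (f x) (f y) l.
Proof.
move=> f_homo /existsP[p /andP[walk_p /eqP last_p]].
apply/existsP; exists [tuple of map f p].
by rewrite /= (homo_path f_homo walk_p) last_map last_p eqxx.
Qed.

Lemma connect_homo (G H : sgraph) (f : G -> H) (x y : G) :
  {homo f : x y / adj x y} ->
  connect (@adj G) x y -> connect (@adj H) (f x) (f y).
Proof.
move=> f_homo /connectP[p walk_p ->]; apply/connectP; exists (map f p).
  exact: homo_path walk_p.
by rewrite last_map.
Qed.

Section GraphIsomorphism.
Variables (G H : sgraph) (f : G -> H).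
Hypothesis f_bij : bijective f.
Hypothesis f_adj : forall x y, adj (f x) (f y) = adj x y.

Let f_homo : {homo f : x y / adj x y}.
Proof. by move=> x y; rewrite f_adj. Qed.

Let inverse_homo : exists2 g, cancel f g & {homo g : x y / adj x y}.
Proof.
by have [g fK gK] := f_bij; exists g => // x y; rewrite -f_adj !gK.
Qed.

Lemma dist_iso (x y : G) : dist (f x) (f y) = dist x y.
Proof.
have [g fK g_homo] := inverse_homo.
rewrite /dist -(bij_eq_card f_bij); apply: eq_find => l.
apply/idP/idP => [|]; last exact: has_walk_homo.
by move/(has_walk_homo g_homo); rewrite !fK.
Qed.

Lemma connect_iso (x y : G) :
  connect (@adj H) (f x) (f y) = connect (@adj G) x y.
Proof.
have [g fK g_homo] := inverse_homo.
apply/idP/idP => [|]; last exact: connect_homo.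
by move/(connect_homo g_homo); rewrite !fK.
Qed.

End GraphIsomorphism.

Lemma RD_energy_iso (C : numClosedFieldType) (G H : sgraph) :
  graph_iso G H -> RD_energy C G = RD_energy C H.
Proof.
case=> f f_bij f_adj.
pose h (i : 'I_#|G|) : 'I_#|H| := enum_rank (f (enum_val i)).
have h_bij : bijective h.
  exact: bij_comp (enum_rank_bij _) (bij_comp f_bij (enum_val_bij _)).
have RD_mxsub : RD C G = mxsub h h (RD C H).
  apply/matrixP => i j; rewrite !mxE /h !enum_rankK.
  by rewrite (bij_eq f_bij) (connect_iso f_bij f_adj) (dist_iso f_bij f_adj).
by rewrite /RD_energy /eigenvalues RD_mxsub (char_poly_mxsub_bij _ h_bij).
Qed.

Lemma has_walk0 (G : sgraph) (x y : G) : has_walk x y 0 = (x == y).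
Proof.
apply/existsP/idP => [[p]|xy]; first by rewrite tuple0.
by exists [tuple].
Qed.

Lemma has_walk1 (G : sgraph) (x y : G) : has_walk x y 1 = adj x y.
Proof.
apply/existsP/idP => [[p]|xy]; last by exists [tuple y]; rewrite /= xy eqxx.
by case/tupleP: p => z p; rewrite tuple0 /= andbT => /andP[xz /eqP <-].
Qed.

Lemma has_walk2 (G : sgraph) (x z y : G) :
  adj x z -> adj z y -> has_walk x y 2.
Proof.
by move=> xz zy; apply/existsP; exists [tuple z; y]; rewrite /= xz zy eqxx.
Qed.

Lemma adj_neq (G : sgraph) (x y : G) : adj x y -> x != y.
Proof. by apply: contraTneq => ->; rewrite adj_irrefl. Qed.

Lemma dist_adj (G : sgraph) (x y : G) : adj x y -> dist x y = 1%N.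
Proof.
move=> xy; have G_gt1 : (1 < #|G|)%N.
  by apply/card_gt1P; exists x, y; split; rewrite ?adj_neq.
rewrite /dist; case: #|G| G_gt1 => [|[|n]] //= _.
by rewrite has_walk0 (negPf (adj_neq xy)) has_walk1 xy.
Qed.

Lemma dist_common_neighbor (G : sgraph) (x z y : G) :
  x != y -> ~~ adj x y -> adj x z -> adj z y -> dist x y = 2%N.
Proof.
move=> ne_xy nadj_xy xz zy; have G_gt2 : (2 < #|G|)%N.
  apply/card_gt2P; exists x, z, y; split=> //.
  by rewrite (adj_neq xz) (adj_neq zy) eq_sym.
rewrite /dist; case: #|G| G_gt2 => [|[|[|n]]] //= _.
by rewrite has_walk0 (negPf ne_xy) has_walk1 (negPf nadj_xy) (has_walk2 xz zy).
Qed.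

(** * Complete multipartite graphs as colorings *)

Definition complete_coloring (G : sgraph) (K : eqType) (c : G -> K) : Prop :=
  forall x y, adj x y = (c x != c y).

Lemma complete_kpartite_coloring (k : nat) (G : sgraph) :
  (0 < k)%N -> complete_kpartite k G ->
  exists2 c : G -> 'I_k, complete_coloring c & forall l, (0 < class_size c l)%N.
Proof.
move=> k_gt0 [P [partP cardP adjP]]; subst k.
have /card_gt0P[B0 PB0] := k_gt0.
have [/eqP covP trivP P0] := and3P partP.
have pblock_in (x : G) : pblock P x \in P by rewrite pblock_mem // covP inE.
exists (fun x => enum_rank_in PB0 (pblock P x)) => [x y|l].
  rewrite adjP; congr (~~ _); apply/eqP/eqP => [-> //|].
  by apply: enum_rank_in_inj.
have Pl : enum_val l \in P := enum_valP l.
have /set0Pn[x xl] : enum_val l != set0 by apply: contra P0 => /eqP <-.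
by apply/card_gt0P; exists x; rewrite inE (def_pblock trivP Pl xl) enum_valK_in.
Qed.

Lemma coloring_iso (G H : sgraph) (K : finType) (c : G -> K) (d : H -> K)
    (s : K -> K) :
  complete_coloring c -> complete_coloring d -> bijective s ->
  (forall l, class_size d (s l) = class_size c l) -> graph_iso G H.
Proof.
move=> cP dP bij_s sizeE; have s_inj := bij_inj bij_s.
have [l|f bij_f fP] := class_bijection (c := s \o c) (d := d); last first.
  by exists f => // x y; rewrite cP dP !fP (inj_eq s_inj).
have [s' sK s'K] := bij_s; rewrite -[l]s'K sizeE; apply: eq_card => x.
by rewrite !inE /= (inj_eq s_inj).
Qed.

Lemma RD_coloring (C : numClosedFieldType) (G : sgraph) (K : finType)
    (c : G -> K) :
  complete_coloring c -> (forall x, exists z, c z != c x) ->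
  RD C G = partite_mx C (c \o enum_val).
Proof.
move=> cP other_color; apply/matrixP => i j; rewrite !mxE /=.
move: (enum_val i) (enum_val j) (inj_eq enum_val_inj i j) => x y <-.
have [->|ne_xy] /= := eqVneq x y; first by rewrite !eqxx /=; field.
have [adj_xy|nadj_xy] := boolP (adj x y).
  have := adj_xy; rewrite cP dist_adj // connect1 // => /negPf->.
  by rewrite /= addr0 mul0r subr0 invr1.
have [z zx] := other_color x.
have cxy : c x = c y by apply/eqP; move: nadj_xy; rewrite cP negbK.
have adj_xz : adj x z by rewrite cP eq_sym.
have adj_zy : adj z y by rewrite cP -cxy.
rewrite (dist_common_neighbor ne_xy nadj_xy adj_xz adj_zy) cxy eqxx.
by rewrite (connect_trans (connect1 adj_xz) (connect1 adj_zy)) /=; field.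
Qed.

Lemma RD_energy_coloring (C : numClosedFieldType) (G : sgraph) (K : finType)
    (c : G -> K) :
  (1 < #|K|)%N -> complete_coloring c -> (forall l, (0 < class_size c l)%N) ->
  ratio_sum (RD_energy C G + 1) (class_size c) = 2^-1.
Proof.
move=> /card_gt1P[l1 [l2 [_ _ ne_l]]] cP c_gt0.
have class_inhabited l : exists x, c x = l.
  by have /card_gt0P[x] := c_gt0 l; rewrite inE => /eqP; exists x.
have other_color x : exists z, c z != c x.
  have [z1 cz1] := class_inhabited l1; have [z2 cz2] := class_inhabited l2.
  have [eq_x|] := eqVneq (c z1) (c x); last by exists z1.
  by exists z2; rewrite -eq_x cz1 cz2 eq_sym.
have G_gt0 : (0 < #|G|)%N.
  by have [x _] := class_inhabited l1; apply/card_gt0P; exists x.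
rewrite /RD_energy (RD_coloring C cP other_color) -/(energy _).
rewrite -(energy_partite_mx C (c \o enum_val) G_gt0).
apply: eq_bigr => l _.
by rewrite class_size_comp_bij //; exact: enum_val_bij.
Qed.

Lemma RD_energy_add1_gt0 (C : numClosedFieldType) (G : sgraph) :
  0 < RD_energy C G + 1.
Proof. by rewrite ltr_wpDl // sumr_ge0. Qed.

Section TwoValuedColoring.
Variables (C : numClosedFieldType) (G H : sgraph) (K : finType).
Variables (c : G -> K) (d : H -> K) (p r : nat).
Hypotheses (cP : complete_coloring c) (dP : complete_coloring d).
Hypothesis c_gt0 : forall l, (0 < class_size c l)%N.
Hypothesis d_gt0 : forall l, (0 < class_size d l)%N.
Hypotheses (eq_card : #|G| = #|H|) (le_pr : (p <= r)%N).
Hypothesis d_two_valued : two_valued p r (class_size d).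

Let eq_sum : (\sum_l class_size c l = \sum_l class_size d l)%N.
Proof. by rewrite !sum_class_size. Qed.

Lemma two_valued_iso : two_valued p r (class_size c) -> graph_iso G H.
Proof.
move=> c_two_valued.
have [s bij_s sP] :=
  two_valued_bijection le_pr c_two_valued d_two_valued eq_sum.
exact: coloring_iso cP dP bij_s sP.
Qed.

Lemma one_color_iso : (#|K| <= 1)%N -> graph_iso G H.
Proof.
move=> /fintype_le1P K_le1; apply: (coloring_iso cP dP (s := id)) => [|l].
  by exists id.
have all_l : xpredT =1 pred1 l by move=> l'; apply/esym/eqP/K_le1.
by move: eq_sum; rewrite !(big_pred1 l) // => ->.
Qed.

Lemma eq_ratio_sum_RD_energy : (1 < #|K|)%N ->
  ratio_sum (RD_energy C G + 1) (class_size c)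
  = ratio_sum (RD_energy C H + 1) (class_size d).
Proof.
by move=> K_gt1; rewrite RD_energy_coloring ?RD_energy_coloring.
Qed.

Let leif_iso (x y : C) :
  x + 1 <= y + 1 ?= iff two_valued p r (class_size c) ->
  (graph_iso G H -> x = y) -> x <= y /\ (x = y <-> graph_iso G H).
Proof.
rewrite (mono_leif (lerD2r 1)) => le_xy iso_xy; split; first exact: le_xy.
split=> // /eqP; rewrite (eq_leif le_xy); exact: two_valued_iso.
Qed.

Lemma RD_energy_ge_of_inside : (forall l, (p <= class_size c l <= r)%N) ->
  RD_energy C H <= RD_energy C G
  /\ (RD_energy C H = RD_energy C G <-> graph_iso G H).
Proof.
move=> inside; have [K_gt1|/one_color_iso GH] := ltnP 1 #|K|; last first.
  by rewrite (RD_energy_iso C GH).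
apply: leif_iso => [|/RD_energy_iso-> //]; have /card_gt1P[l _] := K_gt1.
by apply: (ratio_sum_eq_leif_inside _ _ d_two_valued eq_sum
  (eq_ratio_sum_RD_energy K_gt1) (c_gt0 l)); rewrite ?RD_energy_add1_gt0.
Qed.

Lemma RD_energy_le_of_outside :
  (forall l, (class_size c l <= p)%N || (r <= class_size c l)%N) ->
  RD_energy C G <= RD_energy C H
  /\ (RD_energy C G = RD_energy C H <-> graph_iso G H).
Proof.
move=> outside; have [K_gt1|/one_color_iso GH] := ltnP 1 #|K|; last first.
  by rewrite (RD_energy_iso C GH).
apply: leif_iso => [|/RD_energy_iso-> //]; have /card_gt1P[l _] := K_gt1.
by apply: (ratio_sum_eq_leif_outside _ _ d_two_valued eq_sum
  (eq_ratio_sum_RD_energy K_gt1) (d_gt0 l)); rewrite ?RD_energy_add1_gt0.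
Qed.

End TwoValuedColoring.

Lemma complete_coloring_tag (k : nat) (m : 'I_k -> nat) :
  complete_coloring (fun u : multipartite m => tag u).
Proof. by []. Qed.

Lemma card_multipartite (k : nat) (m : 'I_k -> nat) :
  #|multipartite m| = (\sum_l m l)%N.
Proof.
rewrite -(sum_class_size (fun u : multipartite m => tag u)).
by apply: eq_bigr => l _; exact: class_size_tag.
Qed.

Lemma card_CS (n s : nat) : (s <= n)%N -> #|CS n s| = n.
Proof.
move=> le_sn; rewrite card_multipartite big_ord_recl /= sum_nat_const card_ord.
by rewrite muln1 subnK.
Qed.

Lemma card_turan (n k : nat) : (0 < k)%N -> #|turan n k| = n.
Proof.
move=> k_gt0; rewrite card_multipartite.
transitivity (\sum_(i < k) (n %/ k + (i < n %% k)))%N.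
  by apply: eq_bigr => i _; case: ifP; rewrite ?addn1 ?addn0.
rewrite big_split sum_nat_const card_ord /= mulnC [RHS](divn_eq n k).
congr (_ + _)%N; rewrite -big_mkcond /= -(big_ord_widen _ (fun=> 1%N)).
  by rewrite sum_nat_const card_ord muln1.
exact/ltnW/ltn_pmod.
Qed.

Section ExtremalColorings.
Variables (C : numClosedFieldType) (G : sgraph) (k : nat) (c : G -> 'I_k).
Hypotheses (k_gt0 : (0 < k)%N) (cP : complete_coloring c).
Hypothesis c_gt0 : forall l, (0 < class_size c l)%N.

Let leq_colors_card : (k <= #|G|)%N.
Proof. by rewrite -[leqLHS]card_ord (leq_card_classes c_gt0). Qed.

Lemma RD_energy_ge_CS :
  RD_energy C (CS #|G| k.-1) <= RD_energy C G
  /\ (RD_energy C (CS #|G| k.-1) = RD_energy C G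
      <-> graph_iso G (CS #|G| k.-1)).
Proof.
have := leq_colors_card; case: k k_gt0 c cP c_gt0 => //= s _ e eP e_gt0 lt_sG.
apply: (RD_energy_ge_of_inside C eP (@complete_coloring_tag _ _) e_gt0 (p := 1)
  (r := (#|G| - s)%N)) => [l||||l].
- by rewrite class_size_tag; case: ifP; rewrite ?subn_gt0.
- by rewrite card_CS // ltnW.
- by rewrite subn_gt0.
- by apply/forallP => l; rewrite class_size_tag; case: ifP; rewrite eqxx ?orbT.
rewrite e_gt0 leq_subRL ?(ltnW lt_sG) // addnC -ltnS -addnS.
by have := class_size_add_card l e_gt0; rewrite card_ord.
Qed.

Lemma RD_energy_le_turan :
  RD_energy C G <= RD_energy C (turan #|G| k)
  /\ (RD_energy C G = RD_energy C (turan #|G| k)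
      <-> graph_iso G (turan #|G| k)).
Proof.
apply: (RD_energy_le_of_outside C cP (@complete_coloring_tag _ _) c_gt0
  (p := (#|G| %/ k)%N) (r := (#|G| %/ k).+1)) => [l||||l].
- by rewrite class_size_tag; case: ifP; rewrite ?divn_gt0 ?leq_colors_card.
- by rewrite card_turan.
- exact: leqnSn.
- by apply/forallP => l; rewrite class_size_tag; case: ifP; rewrite eqxx ?orbT.
by rewrite leqNgt orNb.
Qed.

End ExtremalColorings.

Theorem theorem6 (C : numClosedFieldType) (n k : nat) (G : sgraph)
    (k_gt0 : (0 < k)%N) (card_G : #|G| = n) (G_kpart : complete_kpartite k G) :
  [/\ RD_energy C (CS n k.-1) <= RD_energy C G,
      RD_energy C G <= RD_energy C (turan n k),
      RD_energy C (CS n k.-1) = RD_energy C G <-> graph_iso G (CS n k.-1)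
    & RD_energy C G = RD_energy C (turan n k) <-> graph_iso G (turan n k)].
Proof.
have [c cP c_gt0] := complete_kpartite_coloring k_gt0 G_kpart.
have [CS_le CS_eq] := RD_energy_ge_CS C k_gt0 cP c_gt0.
have [turan_ge turan_eq] := RD_energy_le_turan C k_gt0 cP c_gt0.
by rewrite -card_G.
Qed.
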